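(* Let $G$ be a finite $2$-group, and let $A$ be a finite $2$-group acting on $G$ by automorphisms. Then the following assertions are equivalent: (i) $G$ is $d$-maximal for $A$-subgroups. (ii) $G/\gamma_3(G)$ (with the induced action of $A$) is $d$-maximal for $A$-subgroups. (iii) $d(H)<d(G)$ for every proper $A$-subgroup $H<G$ containing $\gamma_2(G)$.
   Context: All groups are finite. For a finite $p$-group $G$, $d(G)$ denotes the minimal number of generators of $G$. If a group $A$ acts on $G$ (by automorphisms), an $A$-subgroup of $G$ is a subgroup of $G$ which is $A$-invariant. The group $G$ is called $d$-maximal for $A$-subgroups if $d(H)<d(G)$ for every proper $A$-subgroup $H$ of $G$. $(\gamma_n(G))_{n\geq 1}$ is the lower central series of $G$, with $\gamma_1(G)=G$ and $\gamma_{n+1}(G)=[\gamma_n(G),G]$. *)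

(* Defs.v *)
From mathcomp Require Import all_boot all_fingroup all_solvable.

Set Implicit Arguments.
Unset Strict Implicit.
Unset Printing Implicit Defensive.

Local Open Scope group_scope.

(* 'm(G) is the library's minimal cardinality of a generating set, d(G). *)
Definition d_maximal (aT rT : finGroupType) (D : {set aT}) (R : {set rT})
    (to : groupAction D R) (A : {group aT}) (G : {group rT}) : Prop :=
  forall H : {group rT},
    H \proper G -> [acts A, on H | to] -> 'm(H) < 'm(G).

(* Main.v *)
(* Write L_i for the lower central series of G, and let ( * ) be the condition
   |H : Phi(H) L_3| < |G : Phi(G)| for all proper A-subgroups H containing L_2,
   which follows from each of the three assertions.  Assume ( * ).
   - Taking for H the preimage of Ohm_1(G / L_2) shows that Phi(G) = L_2.
   - L_3 = Phi(L_2).  Otherwise there is an A-invariant normal subgroup N of G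
     of index 2 in L_3 and containing Phi(L_2).  Let K be the centralizer of
     L_2 mod N in G, and B that of G mod N in L_2.  The commutator pairing of
     G / K and L_2 / B gives |G : K| <= |L_2 : B|, and Phi(K) <= B because
     [a^2, g] = [a, g]^2 = 1 mod N for a in K.  Thus K violates ( * ).
   - It follows that Phi(L_i) = L_(i+1) for i >= 2, so that L_2 behaves like a
     powerful group: squaring maps L_i / L_(i+1) onto L_(i+1) / L_(i+2), and
     by descending induction d(Y) <= d(L_i) for every subgroup Y of L_i.
   - For any H <= G, comparing H with H L_2 and using d(H :&: L_2) <= d(L_2)
     gives |H : Phi(H)| <= |H L_2 : Phi(H L_2) L_3|, and ( * ) applies to H L_2.
   Replacing the action of A by conjugation in the semidirect product turns
   A-subgroups that contain L_2 into normal subgroups of a 2-group. *)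

Require Import Defs.
From mathcomp Require Import all_boot all_fingroup all_solvable.

Set Implicit Arguments.
Unset Strict Implicit.
Unset Printing Implicit Defensive.

Local Open Scope group_scope.

(** * Generator rank and Frattini index of p-groups *)

Section PGroups.

Variables (gT : finGroupType) (p : nat).
Implicit Types G H K R T Y : {group gT}.

(** Burnside's basis theorem: lifts of a minimal generating set of G / Phi(G) generate G, because
    Phi(G) consists of nongenerators. *)
Lemma grank_index_Phi G : p.-group G -> 'm(G) = logn p #|G : 'Phi(G)|.
Proof.
move=> pG; have abQ := Phi_quotient_abelem pG; have cQQ := abelem_abelian abQ.
have nPG : G \subset 'N('Phi(G)) := gFnorm _ _.
rewrite -card_quotient // -(rank_abelem abQ) -grank_abelian //.
apply/eqP; rewrite eqn_leq quotient_grank // andbT.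
have [B defB <-] := grank_witness (G / 'Phi(G)).
pose S := [set repr (set_of_coset u) | u in B].
have SG : S \subset G.
  apply/subsetP=> _ /imsetP[u Bu ->].
  have /morphimP[x nPx Gx ->] : u \in G / 'Phi(G) by rewrite -defB mem_gen.
  rewrite val_coset //; apply: subsetP (mem_repr_rcoset 'Phi(G)%G x).
  by rewrite mul_subG ?Phi_sub ?sub1set.
have SQ : S / 'Phi(G) = B.
  rewrite /quotient morphimEsub ?(subset_trans SG) // -imset_comp.
  by rewrite (eq_imset (g := id)) ?imset_id // => u; rewrite /= coset_reprK.
have genSG : <<S>> = G.
  rewrite -[RHS](Phi_nongen (X := S)) //; apply/eqP.
  rewrite eqEsubset join_subG Phi_sub SG /= -joing_idr.
  rewrite norm_joinEr ?gen_subG ?(subset_trans SG) // -quotientSK //.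
  by rewrite quotient_gen ?(subset_trans SG) // SQ defB.
have := grank_min S; rewrite genSG => /leq_trans; apply.
exact: leq_imset_card.
Qed.

Lemma index_Phi_leq R Y :
    p.-group R -> Y \subset R ->
    #|Y :&: 'Phi(R) : 'Phi(Y :&: 'Phi(R))| <= #|'Phi(R) : 'Phi('Phi(R))| ->
  #|Y : 'Phi(Y)| <= #|Y : Y :&: 'Phi(R)| *
                   #|'Phi(R) : 'Phi(Y) <*> 'Phi('Phi(R))|.
Proof.
set T := 'Phi(R)%G => pR sYR.
have sFYT : 'Phi(Y) \subset T := PhiS pR sYR.
have sFFT : 'Phi(T) \subset T := Phi_sub T.
have sYTT : Y :&: T \subset T := subsetIr _ _.
have pT : p.-group T := pgroupS (Phi_sub R) pR.
have sFYT' : 'Phi(Y) \subset Y :&: T by rewrite subsetI Phi_sub.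
have nFT : 'Phi(Y) \subset 'N('Phi(T)) := subset_trans sFYT (gFnorm _ _).
set J := ('Phi(Y) <*> 'Phi(T))%G; set D := 'Phi(Y) :&: 'Phi(T).
move=> leYT; rewrite -(Lagrange_index _ sFYT') ?subsetIl // leq_mul2l.
have sJT : J \subset T by rewrite join_subG sFYT.
have cardJ : (#|J| * #|D| = #|'Phi(Y)| * #|'Phi(T)|)%N.
  by rewrite [RHS]mul_cardG /J /= norm_joinEl.
have sFD : 'Phi(Y :&: T) \subset D.
  by rewrite subsetI (PhiS pT) // (PhiS (pgroupS sYR pR)) ?subsetIl.
have f_gt0 : 0 < #|'Phi(Y)| * #|'Phi(T)| by rewrite muln_gt0 !cardG_gt0.
(* Multiplying by |Phi(Y)| |Phi(T)| = |J| |D| clears the indices and leaves |Y :&: T| |Phi(T)| <=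
   |T| |D|, where D contains Phi(Y :&: T). *)
apply/orP; right; rewrite -(leq_pmul2r f_gt0) -{2}cardJ !mulnA.
rewrite [X in X * _ <= _]mulnC Lagrange // [X in _ <= X * _]mulnC Lagrange //.
apply: leq_trans (_ : #|T| * #|'Phi(Y :&: T)| <= _); last first.
  by rewrite leq_mul2l subset_leq_card ?orbT.
rewrite -(Lagrange (Phi_sub (Y :&: T))).
rewrite -[X in _ <= X * _](Lagrange (Phi_sub T)).
by rewrite -mulnA mulnC leq_mul2r /= mulnC leq_mul2l leYT !orbT.
Qed.
End PGroups.

(** * Commutators and squares along the lower central series *)

Section Commutators.

Variable gT : finGroupType.
Implicit Types G H K M : {group gT}.

(** Three subgroups lemma modulo [K, G, G]. *)
Lemma commg_der1_sub G K : K <| G -> [~: K, G^`(1)] \subset [~: K, G, G].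
Proof.
case/andP=> sKG nKG; pose N := [~: K, G, G]%G.
change ([~: K, G^`(1)] \subset N).
have sKGG : [~: K, G] \subset G by rewrite comm_subG.
have nNG : G \subset 'N(N) by rewrite normsR ?normsR ?normG.
have nN H : H \subset G -> H \subset 'N(N) by move/subset_trans; apply.
have sG'G : G^`(1) \subset G := der_sub 1 G.
rewrite -quotient_sub1 ?comm_subG ?nN //=.
have KG1 : [~: K, G^`(1)] / N = 1; last by rewrite KG1.
have -> : [~: K, G^`(1)] / N = [~: G / N, G / N, K / N].
  by rewrite quotientR ?nN // quotient_der ?nN // commGC.
have KGG1 : [~: K / N, G / N, G / N] = 1.
  by rewrite -!quotientR ?nN // quotientS1 /=.
by apply: three_subgroup => //; rewrite (commGC (G / N) (K / N)).
Qed.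

(** The expansion [u^2, g] = [u, g]^2 [u, g, u]^[u, g] trades squares of commutators for commutators
    with squares. *)
Lemma mem_commg_sqr M u g :
    [~ u, g] \in 'N(M) -> [~ u, g, u] \in M ->
  ([~ u ^+ 2, g] \in M) = ([~ u, g] ^+ 2 \in M).
Proof.
move=> nMc cuM.
have -> : [~ u ^+ 2, g] = [~ u, g] ^+ 2 * [~ u, g, u] ^ [~ u, g].
  by rewrite expgS expg1 commMgR -[LHS]mulgA (conjgC [~ u, g, u]) mulgA.
by rewrite groupMr // memJ_norm.
Qed.

(** In the nilpotent group G / M only the trivial subgroup lies in its own commutator with the whole
    group. *)
Lemma nil_sub_commg G K M :
    nilpotent G -> K \subset G -> G \subset 'N(M) ->
  K \subset M <*> [~: K, G] -> K \subset M.
Proof.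
move=> nilG sKG nMG sKM; have nMK := subset_trans sKG nMG.
have nMR : [~: K, G] \subset 'N(M) by rewrite (subset_trans _ nMG) ?comm_subG.
rewrite -quotient_sub1 //; apply/trivgP/eqP.
have := quotient_nil M nilG => /forall_inP/(_ (K / M)%G); apply.
rewrite subsetI quotientS //= -quotientR //.
by rewrite quotientSK // -norm_joinEr.
Qed.

(** Modulo M the group is abelian, so checking squares on generators suffices. *)
Lemma Phi_gen_sub (B : {set gT}) M :
    2.-group <<B>> -> <<B>> \subset 'N(M) -> <<B>>^`(1) \subset M ->
  {in B, forall x, x ^+ 2 \in M} -> 'Phi(<<B>>) \subset M.
Proof.
move=> pB nMB sB'M sqB; apply: (Phi_min pB) => //.
have cBB : abelian (<<B>> / M) by rewrite sub_der1_abelian.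
have nMB' : B \subset 'N(M) := subset_trans (subset_gen _) nMB.
rewrite quotient_gen // abelian_gen in cBB *; apply: exponent2_abelem.
rewrite /= abelian_exponent_gen //; apply/exponentP=> _ /morphimP[x nMx Bx ->].
by rewrite -morphX //= coset_id ?sqB.
Qed.


Lemma sqr_mem_Phi G x : 2.-group G -> x \in G -> x ^+ 2 \in 'Phi(G).
Proof.
move=> pG Gx; rewrite (Phi_joing pG) mem_gen // inE orbC.
by rewrite (Mho_p_elt 1 Gx (mem_p_elt pG Gx)).
Qed.

Lemma Phi_sub_sqr G M :
    2.-group G -> G \subset 'N(M) -> {in G, forall x, x ^+ 2 \in M} ->
  'Phi(G) \subset M.
Proof.
move=> pG nMG sqG; apply: (Phi_min pG) => //; apply: exponent2_abelem.
apply/exponentP=> _ /morphimP[x nMx Gx ->].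
by rewrite -morphX //= coset_id ?sqG.
Qed.

(** Induction along the series: modulo the target term [u, g]^2 = [u^2, g], and u^2 already lies one
    term below u. *)
Lemma Phi_lcn_sub n G :
    2.-group G -> 'Phi(G) \subset 'L_2(G) ->
  'Phi('L_n.+1(G)) \subset 'L_n.+2(G).
Proof.
move=> pG sPL; elim: n => // n IHn.
have nLG := lcn_norm n.+3 G; have nLL k : 'L_k(G) \subset 'N('L_n.+3(G)).
  exact: subset_trans (lcn_sub k G) nLG.
have pL k : 2.-group 'L_k(G) := pgroupS (lcn_sub k G) pG.
have L'L : 'L_n.+2(G)^`(1) \subset 'L_n.+3(G).
  by rewrite [in X in _ \subset X]lcnSn commgS ?lcn_sub.
apply: (Phi_gen_sub (B := commg_set 'L_n.+1(G) G) (pL n.+2) (nLL n.+2) L'L).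
move=> _ /imset2P[u g Lu Gg ->].
have Lc : [~ u, g] \in 'L_n.+2(G) by rewrite lcnSn mem_commg.
have u2L : u ^+ 2 \in 'L_n.+2(G) by rewrite (subsetP IHn) ?sqr_mem_Phi ?pL.
have cuL : [~ u, g, u] \in 'L_n.+3(G).
  by rewrite lcnSn mem_commg // (subsetP (lcn_sub n.+1 G)).
rewrite -(mem_commg_sqr (M := 'L_n.+3(G)%G) _ cuL) ?(subsetP (nLL n.+2)) //.
by change ([~ u ^+ 2, g] \in 'L_n.+3(G)); rewrite lcnSn mem_commg.
Qed.

(** By induction L_(n+4) = [L_(n+3), G] <= [Phi(L_(n+2)), G], so it is enough that squares from
    L_(n+2) are central modulo M = Phi(L_(n+3)) L_(n+5); nilpotency then removes L_(n+5). *)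
Lemma lcn_sub_Phi n G :
    2.-group G -> 'L_3(G) \subset 'Phi('L_2(G)) ->
  'L_n.+3(G) \subset 'Phi('L_n.+2(G)).
Proof.
move=> pG sLF; elim: n => // n IHn.
have pL k : 2.-group 'L_k(G) := pgroupS (lcn_sub k G) pG.
have nFG : G \subset 'N('Phi('L_n.+3(G))).
  by rewrite (char_norm_trans (Phi_char _)) ?lcn_norm.
apply: (nil_sub_commg (pgroup_nil pG)) => //; first exact: lcn_sub.
rewrite -lcnSn.
pose M := ('Phi('L_n.+3(G)) <*> 'L_n.+4.+1(G))%G.
have nMG : G \subset 'N(M) by rewrite normsY ?lcn_norm.
change ('L_n.+4(G) \subset M).
have sLM : 'Phi('L_n.+2(G)) \subset coset M @*^-1 'C(G / M).
  apply: (Phi_sub_sqr (pL n.+2)); first apply: norm_quotient_pre.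
  - exact: subset_trans (lcn_sub _ _) nMG.
  - by rewrite (subset_trans (quotientS _ (lcn_sub _ _))) ?norms_cent ?normG.
  move=> u Lu; have Gu := subsetP (lcn_sub _ _) _ Lu.
  rewrite mem_morphpre ?(subsetP nMG) ?groupX //.
  apply/centP=> _ /morphimP[g Ng Gg ->]; apply/commgP.
  rewrite -morphR ?(subsetP nMG) ?groupX //.
  apply/eqP; apply: coset_id.
  have Lc : [~ u, g] \in 'L_n.+3(G) by rewrite lcnSn mem_commg.
  rewrite mem_commg_sqr ?(subsetP nMG) ?(subsetP (lcn_sub n.+3 G)) //.
    by rewrite mem_gen // inE sqr_mem_Phi ?pL.
  rewrite mem_gen // inE orbC.
  (* Since u lies in L_2 = G', the commutator [u, g, u] is two terms below [u, g], not just one. *)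
  have sL2 : [~: 'L_n.+3(G), 'L_2(G)] \subset 'L_n.+4.+1(G).
    by rewrite !(lcnSn _.+2) commg_der1_sub ?lcn_normal.
  by rewrite (subsetP sL2) ?mem_commg // (subsetP (lcn_sub_leq _ _) _ Lu).
rewrite lcnSn; apply: subset_trans (commSg G IHn) _.
rewrite -quotient_cents2 // ?sub_quotient_pre //.
  exact: subset_trans (subset_trans (Phi_sub _) (lcn_sub _ _)) nMG.
exact: subset_trans (subset_trans (Phi_sub _) (lcn_sub _ _)) nMG.
Qed.

End Commutators.

(** * Squaring maps and Frattini indices of subgroups of L_2 *)

Section Squaring.

Variable gT : finGroupType.
Implicit Types G T Y : {group gT}.

(** Squaring is an endomorphism of the abelian group T / Phi(Phi(T)). Modulo Phi(Phi(T)) it sends T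
    onto Phi(T) and Y Phi(T) into Phi(Y), and a homomorphism cannot increase an index. *)
Lemma index_Phi_join_leq T Y :
    2.-group T -> T^`(1) \subset 'Phi('Phi(T)) -> Y \subset T ->
  #|'Phi(T) : 'Phi(Y) <*> 'Phi('Phi(T))| <= #|T : Y <*> 'Phi(T)|.
Proof.
move=> pT sT'N sYT; pose N := 'Phi('Phi(T))%G.
have sNF : N \subset 'Phi(T) := Phi_sub _.
have sFT : 'Phi(T) \subset T := Phi_sub _.
have nNT : T \subset 'N(N) by rewrite (char_norm_trans (Phi_char _)) ?gFnorm.
have cQQ : abelian (T / N) by rewrite sub_der1_abelian.
have sqM : {in T / N &, {morph (fun x => x ^+ 2) : x y / x * y}}.
  by move=> x y Qx Qy /=; rewrite expgMn //; apply: (centsP cQQ).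
pose f := Morphism sqM.
have fE (H : {group gT}) (K : {group gT}) :
    H \subset T -> {in H, forall x, x ^+ 2 \in K} -> f @* (H / N) \subset K / N.
  move=> sHT sqH; apply/subsetP=> _ /morphimP[_ _ /morphimP[x Nx Hx ->] ->] /=.
  by rewrite -morphX // mem_quotient ?sqH.
have sFfQ : 'Phi(T) / N \subset f @* (T / N).
  rewrite (quotient_Phi pT) // (Phi_Mho (p := 2)) ?quotient_pgroup //
    (MhoEabelian 1 (p := 2)) ?quotient_pgroup //.
  by apply/subsetP=> _ /imsetP[x Qx ->]; rewrite (mem_morphim f).
have -> : #|'Phi(T) : 'Phi(Y) <*> N| = #|'Phi(T) / N : 'Phi(Y) / N|.
  rewrite -(quotientYidr (subset_trans (Phi_sub Y) (subset_trans sYT nNT))).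
  rewrite index_quotient_eq ?join_subG ?sNF ?(PhiS pT) ?(subset_trans sFT) //.
  by rewrite subIset // joing_subr orbT.
have -> : #|T : Y <*> 'Phi(T)| = #|T / N : (Y <*> 'Phi(T)) / N|.
  rewrite index_quotient_eq ?join_subG ?sYT //.
  by rewrite subIset // (subset_trans sNF) ?joing_subr ?orbT.
have -> : 'Phi(T) / N = f @* (T / N).
  by apply/eqP; rewrite eqEsubset sFfQ fE // => x Tx; rewrite sqr_mem_Phi.
apply: leq_trans (dvdn_leq _ (index_morphim f _)); rewrite ?subsetIl //.
apply: dvdn_leq => //; apply: indexgS.
change (f @* ((Y <*> 'Phi(T)) / N) \subset 'Phi(Y) / N).
rewrite quotientY ?(subset_trans sFT) ?(subset_trans sYT) //.
rewrite morphimY ?quotientS // join_subG fE //=; last first.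
  by move=> x Yx; rewrite sqr_mem_Phi ?(pgroupS sYT).
rewrite (subset_trans (fE ('Phi(T))%G N _ _)) ?trivg_quotient ?sub1G //.
by move=> x Fx; rewrite sqr_mem_Phi ?(pgroupS sFT).
Qed.

(** Induction on |L_(n+2)|: T = Phi(L_(n+2)) is the next term, so the bound holds for Y :&: T. Then
    [index_Phi_leq] and [index_Phi_join_leq] bound |Y : Phi(Y)| by |Y T : T| |L_(n+2) : Y T|. *)
Lemma index_Phi_lcn n G Y :
    2.-group G -> 'Phi(G) \subset 'L_2(G) -> 'L_3(G) \subset 'Phi('L_2(G)) ->
    Y \subset 'L_n.+2(G) ->
  #|Y : 'Phi(Y)| <= #|'L_n.+2(G) : 'Phi('L_n.+2(G))|.
Proof.
move=> pG sPL sLP.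
have defPhi k : 'Phi('L_k.+2(G)) = 'L_k.+3(G).
  by apply/eqP; rewrite eqEsubset Phi_lcn_sub // lcn_sub_Phi.
have pL k : 2.-group 'L_k(G) := pgroupS (lcn_sub k G) pG.
have [m] := ubnP #|'L_n.+2(G)|; elim: m n Y => // m IHm n Y.
rewrite ltnS => lem sYL.
have [L1 | ntL] := eqVneq 'L_n.+2(G) 1.
  by rewrite L1 in sYL *; rewrite (trivgP sYL).
have Lproper := Phi_proper ntL.
set T := 'Phi('L_n.+2(G))%G.
have leYT : #|Y :&: T : 'Phi(Y :&: T)| <= #|T : 'Phi(T)|.
  have := IHm n.+1 (Y :&: T)%G; rewrite -(defPhi n).
  apply; last exact: subsetIr.
  exact: leq_trans (proper_card Lproper) _.
have sTL : T \subset 'L_n.+2(G) := Phi_sub _.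
have sYTL : Y <*> T \subset 'L_n.+2(G) by rewrite join_subG sYL.
have iYT : #|Y <*> T : T| = #|Y : Y :&: T|.
  by rewrite joingC norm_joinEr ?(subset_trans sYL) ?gFnorm // indexMg indexgI.
apply: leq_trans (index_Phi_leq (pL n.+2) sYL leYT) _.
rewrite -(Lagrange_index sYTL (joing_subr _ _)) iYT mulnC leq_mul //.
apply: (index_Phi_join_leq (pL n.+2) _ sYL).
(* With L = L_(n+2): L' <= [L, L_2] <= [L, G, G] = Phi(Phi(L)). *)
have -> : 'Phi('Phi('L_n.+2(G))) = [~: 'L_n.+2(G), G, G] by rewrite !defPhi.
apply: subset_trans (commg_der1_sub (lcn_normal n.+2 G)).
by rewrite commgS // (lcn_sub_leq G (isT : 1 < n.+2)).
Qed.

End Squaring.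

(** * Duality bound for a commutator pairing *)

Section Duality.

Variable gT : finGroupType.
Implicit Types G U Z : {group gT}.

(** Each element added to S multiplies the index of the centralizer by at most a class size. *)
Lemma index_cent_leq G (S : {set gT}) n :
    {in S, forall x, #|x ^: G| <= n} -> #|G : 'C_G(S)| <= n ^ #|S|.
Proof.
have [m] := ubnP #|S|; elim: m S => // m IHm S; rewrite ltnS => leS clS.
have [-> | [x Sx]] := set_0Vmem S.
  by rewrite -cent_gen gen0 cent1T setIT indexgg cards0.
have leSx : #|S :\ x| < m by rewrite (cardsD1 x) Sx add1n in leS.
rewrite [in X in _ <= X](cardsD1 x) Sx add1n expnSr.
rewrite -[in X in X <= _](setD1K Sx).
rewrite centU cent_set1 setIA setIAC.
rewrite -(@Lagrange_index _ G 'C_G(S :\ x)%G) ?subsetIl // leq_mul //.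
  by apply: IHm => // y /setD1P[_ /clS].
rewrite index_cent1; apply: leq_trans (clS x Sx); apply: subset_leq_card.
by rewrite imsetS ?subsetIl.
Qed.

(* The commutator map G / C_G(U) x U / C_U(G) -> Z is a nondegenerate pairing
   into a group of prime order. *)
Lemma index_cent_abelem p G U Z :
    p.-abelem U -> U \subset G -> [~: U, G] \subset Z -> #|Z| = p ->
  #|G : 'C_G(U)| <= #|U : 'C_U(G)|.
Proof.
move=> abU sUG sUGZ oZ.
(* A complement D of C_U(G) has order |U : C_U(G)|, and a minimal generating set S of D satisfies
   C_G(S) = C_G(U). *)
have [D /complP[tiD defU]] := splitsP (abelem_splits abU (subsetIl U 'C(G))).
have sDU : D \subset U by rewrite -defU mulG_subr.
have abD := abelemS sDU abU.
have [S defD cardS] := grank_witness D.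
have -> : #|U : 'C_U(G)| = #|D|.
  by rewrite -{1}defU indexMg -indexgI setIC tiD indexg1.
have -> : 'C_G(U) = 'C_G(S).
  rewrite -(cent_gen S) defD -defU centM setIA.
  by have /setIidPl-> : G \subset 'C('C_U(G)) by rewrite centsC subsetIr.
have -> : #|D| = (p ^ #|S|)%N.
  rewrite cardS grank_abelian ?(abelem_abelian abD) // (rank_abelem abD) //.
  by rewrite -card_pgroup ?(abelem_pgroup abD).
(* Each class x^G lies in the coset x Z, which has p elements. *)
apply: index_cent_leq => x Sx; rewrite -oZ.
have Ux : x \in U by rewrite (subsetP sDU) // -defD mem_gen.
rewrite -(card_lcoset Z x); apply: subset_leq_card.
apply/subsetP=> _ /imsetP[g Gg ->]; rewrite mem_lcoset -commgEl.
by rewrite (subsetP sUGZ) ?mem_commg.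
Qed.

End Duality.

(** * Comparison of H with H L_2 *)

Section Reduction.

Variable gT : finGroupType.
Implicit Types G H X : {group gT}.

Lemma index_Phi_join_lcn G H :
    2.-group G -> 'Phi(G) = 'L_2(G) -> 'L_3(G) \subset 'Phi('L_2(G)) ->
    H \subset G ->
  #|H : 'Phi(H)| <= #|H <*> 'L_2(G) : 'Phi(H <*> 'L_2(G)) <*> 'L_3(G)|.
Proof.
move=> pG defL2 sLP sHG; set T := 'L_2(G)%G; set W := H <*> T.
have sTG : T \subset G := lcn_sub 2 G.
have pL k : 2.-group 'L_k(G) := pgroupS (lcn_sub k G) pG.
have sPL : 'Phi(G) \subset 'L_2(G) by rewrite defL2.
have defPT : 'Phi(T) = 'L_3(G).
  by apply/eqP; rewrite eqEsubset sLP (Phi_lcn_sub 1).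
have leHT :
    #|H :&: 'Phi(G) : 'Phi(H :&: 'Phi(G))| <= #|'Phi(G) : 'Phi('Phi(G))|.
  have := index_Phi_lcn (n := 0) (Y := (H :&: 'Phi(G))%G) pG sPL sLP.
  rewrite -defL2; apply.
  exact: subsetIr.
have leH : #|H : 'Phi(H)| <= #|H : H :&: T| * #|T : 'Phi(H) <*> 'L_3(G)|.
  by have := index_Phi_leq pG sHG leHT; rewrite defL2 -defPT.
apply: leq_trans leH _.
have sTW : T \subset W := joing_subr _ _.
have iW : #|H : H :&: T| = #|W : T|.
  rewrite /W joingC norm_joinEr ?(subset_trans sHG) ?lcn_norm //.
  by rewrite indexMg indexgI.
have sJT : 'Phi(H) <*> 'L_3(G) \subset T.
  by rewrite join_subG lcn_subS andbT (subset_trans (PhiS pG sHG)) ?defL2.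
rewrite iW Lagrange_index //; apply: dvdn_leq => //; apply: indexgS.
have cTQ : T / 'L_3(G) \subset 'C(G / 'L_3(G)).
  by have := lcn_central 2 G; rewrite subsetI => /andP[].
(* Modulo L_3 the group T is central with trivial Frattini subgroup, so Phi(W) and Phi(H) have the
   same image. *)
change ('Phi(W) <*> 'L_3(G) \subset 'Phi(H) <*> 'L_3(G)).
rewrite join_subG joing_subr andbT.
have nLG : G \subset 'N('L_3(G)) := lcn_norm 3 G.
have sWG : W \subset G by rewrite join_subG sHG.
have -> : (('Phi(H) <*> 'L_3(G))%G : {set gT}) = 'L_3(G) * 'Phi(H).
  by rewrite /= joingC norm_joinEr // gFsub_trans ?(subset_trans sHG).
rewrite -quotientSK ?gFsub_trans ?(subset_trans sWG) //.
rewrite !(quotient_Phi (p := 2)) ?(subset_trans _ nLG) ?(pgroupS _ pG) //.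
rewrite quotientY ?(subset_trans _ nLG) //.
have cTH : T / 'L_3(G) \subset 'C(H / 'L_3(G)).
  by rewrite (subset_trans cTQ) ?centS ?quotientS.
rewrite cent_joinEr // (Phi_mulg (p := 2)) ?quotient_pgroup ?(pgroupS _ pG) //.
rewrite -(quotient_Phi (pL 2)) ?(subset_trans sTG) //.
by rewrite defPT trivg_quotient mulg1.
Qed.
End Reduction.

(** * Internal form: the action becomes conjugation in a 2-group X *)

Section Internal.

Variable gT : finGroupType.
Variables G X : {group gT}.
(** X stands for the semidirect product of G and A. In [dmaxG] the left index is 2 to the power d(H
    / L_3). *)
Hypotheses (pX : 2.-group X) (nsGX : G <| X).
Hypothesis dmaxG : forall H : {group gT},
  H <| X -> 'L_2(G) \subset H -> H \proper G ->
  #|H : 'Phi(H) <*> 'L_3(G)| < #|G : 'Phi(G)|.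

Let pG : 2.-group G := pgroupS (normal_sub nsGX) pX.
Let pL k : 2.-group 'L_k(G) := pgroupS (lcn_sub k G) pG.

Lemma Phi_eq_lcn2 : 'Phi(G) = 'L_2(G).
Proof.
have sL2P : 'L_2(G) \subset 'Phi(G) by rewrite (Phi_joing pG) joing_subl.
apply/eqP; rewrite eqEsubset sL2P andbT; set L := 'L_2(G)%G.
have nLG : G \subset 'N(L) := lcn_norm 2 G.
have cQQ : abelian (G / L) := der_abelian 0 G.
have pQ : 2.-group (G / L) := quotient_pgroup _ pG.
pose H := (coset L @*^-1 'Ohm_1(G / L))%G.
have defHL : H / L = 'Ohm_1(G / L) := cosetpreK _.
have sHG : H \subset G.
  by rewrite -(quotientGK (lcn_normal 2 G)) morphpreS ?Ohm_sub.
have sLH : L \subset H := sub_cosetpre _.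
have sPHL : 'Phi(H) \subset L.
  apply: (Phi_min (pgroupS sHG pG) (subset_trans sHG nLG)).
  by rewrite [H / L]defHL Ohm1_abelem.
have chH : H \char G.
  apply: (char_from_quotient (H := L)) => //; last by rewrite defHL Ohm_char.
  - by rewrite /normal sLH (subset_trans sHG).
  - exact: lcn_char.
(* In the abelian group Q = G / L, |Ohm_1(Q)| = |Q : Mho^1(Q)| and Mho^1(Q) = Phi(Q). *)
have iH : #|H : L| = #|G : 'Phi(G)|.
  rewrite -card_quotient ?(subset_trans sHG) // defHL.
  have := mul_card_Ohm_Mho_abelian 1 cQQ; rewrite -(Phi_Mho pQ cQQ).
  rewrite -(quotient_Phi pG nLG) => iQ.
  have -> : #|G : 'Phi(G)| = #|G / L : 'Phi(G) / L|.
    by rewrite index_quotient_eq ?Phi_sub // subIset // sL2P orbT.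
  by rewrite -divgS ?quotientS ?Phi_sub // -iQ mulnK.
(* If H = G then Phi(G) = Phi(H) <= L; a proper H would violate [dmaxG]. *)
have [sGH | ] := boolP (G \subset H).
  have eHG : H :=: G by apply/eqP; rewrite eqEsubset sHG.
  by move: sPHL; rewrite eHG.
move=> nsGH; have := dmaxG (char_normal_trans chH nsGX) sLH.
rewrite properE sHG nsGH => /(_ isT); rewrite -iH ltnNge => /negP[].
apply: dvdn_leq => //; apply: indexgS.
by rewrite join_subG sPHL lcn_subS.
Qed.

Lemma lcn3_sub_Phi : 'L_3(G) \subset 'Phi('L_2(G)).
Proof.
have defPG := Phi_eq_lcn2.
set U := 'L_2(G)%G; set V := 'L_3(G)%G; pose F := 'Phi(U)%G.
have sFV : F \subset V by apply: (Phi_lcn_sub 1 pG); rewrite defPG.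
have nX (K : {group gT}) : K \char G -> X \subset 'N(K).
  by move/char_norm_trans; apply; apply: normal_norm.
have chU : U \char G := lcn_char 2 G; have chV : V \char G := lcn_char 3 G.
have chF : F \char G := char_trans (Phi_char U) chU.
have sGX := normal_sub nsGX; have sUG := char_sub chU; have sVG := char_sub chV.
change (V \subset F); apply: contraT => nsVF.
have [N [nNX sFN sNV iVN]] : exists N : {group gT},
    [/\ X \subset 'N(N), F \subset N, N \subset V & #|V : N| = 2].
  have pVF : 2.-group (V / F) by rewrite quotient_pgroup ?(pgroupS sVG pG).
  have nsVFX : V / F <| X / F.
    by rewrite quotient_normal // /normal nX ?(subset_trans sVG).
  have ntVF : V / F != 1.
    by rewrite -subG1 quotient_sub1 // (subset_trans sVG) ?char_norm.
  (* A normal subgroup of a p-group contains normal subgroups of the whole group of every admissible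
     order; the exponent one below that of |V / F| gives index 2. *)
  have [Q [sQV nsQX cardQ]] :=
    normal_pgroup (quotient_pgroup F pX) nsVFX (leq_pred _).
  exists (coset F @*^-1 Q)%G; split.
  - by rewrite norm_quotient_pre ?nX ?normal_norm.
  - exact: sub_cosetpre.
  - by rewrite -(quotientGK (normalS sFV sVG (char_normal chF))) morphpreS.
  - rewrite -[in LHS](quotientGK (normalS sFV sVG (char_normal chF))).
    rewrite index_cosetpre -divgS // cardQ {1}(card_pgroup pVF).
    have [_ _ [m oVF]] := pgroup_pdiv pVF ntVF.
    by rewrite oVF pfactorK //= expnS mulnK ?expn_gt0.
have sNG := subset_trans sNV sVG; have nNG := subset_trans sGX nNX.
have nNU := subset_trans sUG nNG.
have sNU : N \subset U := subset_trans sNV (lcn_subS 2 G).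
(* A normal subgroup of prime order in a nilpotent group is central. *)
have cVN : V / N \subset 'C(G / N).
  have prVN : prime #|V / N| by rewrite card_quotient ?(subset_trans sVG) ?iVN.
  have nsVN : V / N <| G / N by rewrite quotient_normal ?lcn_normal.
  have nilQ := quotient_nil N (pgroup_nil pG).
  have := prime_meetG prVN (meet_center_nil nilQ nsVN _).
  rewrite -cardG_gt1 prime_gt1 // => /(_ isT).
  by rewrite subsetI => /andP[].
have abU : 2.-abelem (U / N).
  rewrite -trivg_Phi ?quotient_pgroup ?pL // -(quotient_Phi (pL 2)) //.
  by rewrite (quotientS1 sFN).
pose K := (G :&: coset N @*^-1 'C(U / N))%G.
have sKG : K \subset G := subsetIl _ _.
have sUK : U \subset K.
  by rewrite subsetI sUG -sub_quotient_pre //; apply: abelem_abelian abU.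
have nsKX : K <| X.
  rewrite /normal (subset_trans sKG) //=.
  apply: normsI; first exact: normal_norm.
  by apply: norm_quotient_pre => //; rewrite norms_cent // quotient_norms // nX.
have defKN : K / N = 'C_(G / N)(U / N) by rewrite quotientGI // cosetpreK.
have prKG : K \proper G.
  rewrite properE sKG; apply/negP=> sGK.
  have: [~: U, G] \subset N.
    rewrite commGC -quotient_cents2 // sub_quotient_pre //.
    by rewrite (subset_trans sGK) ?subsetIr.
  by rewrite -lcnSn -indexg_eq1 iVN.
pose B := (U :&: coset N @*^-1 'C(G / N))%G.
have sBU : B \subset U := subsetIl _ _.
have sVB : V \subset B.
  by rewrite subsetI lcn_subS -sub_quotient_pre ?(subset_trans sVG).
have defBN : B / N = 'C_(U / N)(G / N).
  by rewrite quotientGI ?cosetpreK // (subset_trans sNV) ?lcn_subS.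
(* For a in K, [a, g, a] lies in [U, K] <= N and [a, g]^2 in Phi(U) <= N, so a^2 is central modulo
   N. *)
have sPKB : 'Phi(K) \subset B.
  rewrite subsetI (subset_trans (PhiS pG sKG)) ?defPG //=.
  apply: (Phi_sub_sqr (pgroupS sKG pG)) => [|a Ka].
    apply: norm_quotient_pre; first exact: subset_trans nNG.
    by rewrite (subset_trans (quotientS _ sKG)) ?norms_cent ?normG.
  have [Ga cUa] := setIP Ka; have Na := subsetP nNG a Ga.
  rewrite mem_morphpre ?groupX //.
  apply/centP=> _ /morphimP[g Ng Gg ->]; apply/commgP.
  rewrite -morphR ?groupX //; apply/eqP; apply: coset_id.
  have Uc : [~ a, g] \in U by rewrite mem_commg.
  rewrite mem_commg_sqr ?(subsetP nNU) //.
    by rewrite (subsetP sFN) // sqr_mem_Phi ?pL.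
  have sUKN : [~: U, K] \subset N.
    rewrite commGC -quotient_cents2 ?(subset_trans sKG) //.
    by rewrite sub_quotient_pre ?subsetIr ?(subset_trans sKG).
  by rewrite (subsetP sUKN) ?mem_commg.
(* Contradiction: |K : Phi(K) L_3| >= |K : B| = |K : U| |U : B| >= |K : U| |G : K| = |G :
   Phi(G)|. *)
have := dmaxG nsKX sUK prKG; rewrite ltnNge => /negP[].
apply: leq_trans (_ : #|K : B| <= _); last first.
  by apply: dvdn_leq => //; apply: indexgS; rewrite join_subG sPKB.
rewrite defPG -(Lagrange_index sKG sUK) -(Lagrange_index sUK sBU).
rewrite mulnC leq_mul //.
have -> : #|G : K| = #|G / N : K / N|.
  by rewrite index_quotient_eq // subIset // (subset_trans sNU) ?orbT.
have -> : #|U : B| = #|U / N : B / N|.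
  by rewrite index_quotient_eq // subIset // (subset_trans sNV) ?orbT.
rewrite [K / N]defKN [B / N]defBN.
apply: (index_cent_abelem (Z := (V / N)%G) abU); rewrite ?quotientS //.
  by rewrite -quotientR.
by rewrite card_quotient // (subset_trans sVG).
Qed.

(** L_2 = Phi(G) consists of nongenerators, so H L_2 is still proper and [dmaxG] applies to it. *)
Lemma index_Phi_proper (H : {group gT}) :
    H \proper G -> H <*> 'L_2(G) <| X -> #|H : 'Phi(H)| < #|G : 'Phi(G)|.
Proof.
move=> prHG nsWX; have sHG := proper_sub prHG; have defPG := Phi_eq_lcn2.
apply: leq_ltn_trans (index_Phi_join_lcn pG defPG lcn3_sub_Phi sHG) _.
apply: (dmaxG (H := (H <*> 'L_2(G))%G)) => //; first exact: joing_subr.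
rewrite properE join_subG sHG lcn_sub /=; apply/negP=> sGW.
have: <<H>> = G.
  apply: Phi_nongen; apply/eqP; rewrite defPG joingC eqEsubset sGW andbT.
  by rewrite join_subG sHG lcn_sub.
by rewrite genGid => eHG; rewrite eHG properxx in prHG.
Qed.

End Internal.

(** * Transfer between the action and the semidirect product *)

Section Transfer.

Lemma logn_ltn_index (gT : finGroupType) (p : nat) (G H K L : {group gT}) :
    p.-group G -> p.-group K -> 1 < p ->
  (logn p #|G : H| < logn p #|K : L|) = (#|G : H| < #|K : L|).
Proof.
move=> pG pK p_gt1; rewrite -(ltn_exp2l _ _ p_gt1) -!p_part.
by rewrite !part_pnat_id ?(pnat_dvd (dvdn_indexg _ _)).
Qed.

Lemma grank_quotient_Phi (gT : finGroupType) (p : nat) (H N : {group gT}) :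
    p.-group H -> N \subset H -> H \subset 'N(N) ->
  'm(H / N) = logn p #|H : 'Phi(H) <*> N|.
Proof.
move=> pH sNH nNH; rewrite (grank_index_Phi (p := p)) ?quotient_pgroup //.
rewrite -(quotient_Phi pH) //.
rewrite -(quotientYidr (subset_trans (Phi_sub H) nNH)) index_quotient_eq //.
  by rewrite subIset // joing_subr orbT.
by rewrite join_subG Phi_sub.
Qed.

Variables (aT gT : finGroupType) (A : {group aT}) (G : {group gT}).
Variable to : groupAction A G.
Hypotheses (pG : 2.-group G) (pA : 2.-group A).

(** The hypothesis follows from each of the three conditions. The embedding [f] into the semidirect
    product preserves Frattini indices and turns invariance under A into normalization by the image
    of A. *)
Lemma d_maximal_quotient_lcn3 :
    (forall H : {group gT}, H \proper G -> [acts A, on H | to] ->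
       'L_2(G) \subset H -> 'm(H / 'L_3(G)) < 'm(G)) ->
  d_maximal to A G.
Proof.
move=> dmax H prHG actH; have sHG := proper_sub prHG.
have pS (K : {group gT}) : K \subset G -> 2.-group K by move/pgroupS; apply.
rewrite !(grank_index_Phi (p := 2)) ?pS // logn_ltn_index ?pS //.
pose f := sdpair1_morphism to; pose X := [set: sdprod_by to]%G.
have injf : 'injm f := injm_sdpair1 to.
have defX := sdprod_sdpair to; have [nsGX _ defGA _ _] := sdprod_context defX.
have pX : 2.-group X.
  by rewrite /= -defGA pgroupM !morphim_pgroup.
have iPhi (K : {group gT}) :
    K \subset G -> #|f @* K : 'Phi(f @* K)| = #|K : 'Phi(K)|.
  by move=> sKG; rewrite -injm_Phi // index_injm.
rewrite -!iPhi //; apply: (index_Phi_proper pX nsGX) => [K' nsKX sLK prK | | ].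
- pose K := (f @*^-1 K')%G.
  have defK : f @* K = K' by apply: morphpreK; apply: proper_sub.
  have sKG : K \subset G := subsetIl _ _.
  have prKG : K \proper G by rewrite -(injm_proper injf) ?defK.
  have actK : [acts A, on K | to].
    rewrite actsEsd // defK.
    exact: subset_trans (subsetT _) (normal_norm nsKX).
  have sL2K : 'L_2(G) \subset K.
    by rewrite -sub_morphim_pre ?lcn_sub // morphim_lcn.
  have := dmax K prKG actK sL2K.
  have sL3K : 'L_3(G) \subset K := subset_trans (lcn_subS 2 G) sL2K.
  rewrite (grank_quotient_Phi (p := 2)) ?pS ?(subset_trans sKG) ?lcn_norm //.
  rewrite (grank_index_Phi (p := 2)) // logn_ltn_index ?pS //.
  rewrite iPhi // -defK -morphim_lcn // -injm_Phi //.
  rewrite -morphimY ?lcn_sub ?gFsub_trans //.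
  by rewrite index_injm.
- by rewrite properE !injmSK.
(* The join of f(H) with L_2 is normalized by f(G), as it contains the derived subgroup, and by A,
   as H is invariant and L_2 characteristic. *)
have sL2G : 'L_2(f @* G) \subset f @* G := lcn_sub 2 _.
have sHfG : f @* H \subset f @* G := morphimS f sHG.
rewrite /normal subsetT /= -defGA mul_subG //.
  by apply: sub_der1_norm; rewrite ?joing_subr // join_subG sHfG.
rewrite normsY -?actsEsd //.
apply: subset_trans (char_norm_trans (lcn_char 2 _) (normal_norm nsGX)).
exact: subsetT.
Qed.

Lemma acts_quotient_lcn (n : nat) (H : {group gT}) :
  [acts A, on H | to] -> [acts A, on H / 'L_n(G) | to / 'L_n(G)].
Proof.
move=> actH; apply: acts_quotient; rewrite subsetI actH andbT.
by rewrite qact_domE ?lcn_sub // acts_char ?lcn_char.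
Qed.

End Transfer.

(** * The cycle of implications *)

Unset Implicit Arguments.

Theorem corollary1p8 (aT gT : finGroupType) (A : {group aT}) (G : {group gT})
    (to : groupAction A G) (pG : 2.-group G) (pA : 2.-group A) :
  [<-> d_maximal to A G;
       d_maximal (to / 'L_3(G))%gact A (G / 'L_3(G))%G;
       forall H : {group gT},
         H \proper G -> [acts A, on H | to] -> 'L_2(G) \subset H ->
         'm(H) < 'm(G)].
Proof.
have nLG : G \subset 'N('L_3(G)) := lcn_norm 3 G.
have sLG : 'L_3(G) \subset G := lcn_sub 3 G.
have sL3P : 'L_3(G) \subset 'Phi(G).
  by rewrite (Phi_joing pG) (subset_trans (lcn_subS 2 G)) ?joing_subl.
have rankQ : 'm(G / 'L_3(G)) = 'm(G).
  rewrite (grank_quotient_Phi pG) // (grank_index_Phi pG).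
  by rewrite (joing_idPl sL3P).
tfae.
(* Lift Q to its invariant preimage H; then d(Q) <= d(H) < d(G) = d(G / L_3). *)
- move=> dmaxG Q prQ actQ; rewrite rankQ.
  have [H defQ sLH sHG] := inv_quotientS (lcn_normal 3 G) (proper_sub prQ).
  rewrite defQ in prQ actQ *.
  apply: leq_ltn_trans (quotient_grank (subset_trans sHG nLG)) _.
  apply: dmaxG.
    by rewrite properE sHG (contra _ (proper_subn prQ)) //; apply: quotientS.
  move: actQ; rewrite astabs_quotient; last exact: normalS (lcn_normal 3 G).
  by rewrite subsetI => /andP[].
(* The second condition gives d-maximality of G itself, hence the third. *)
- move=> dmaxQ H prHG actH _; apply: d_maximal_quotient_lcn3 prHG actH => //.
  move=> K prK actK sL2K; rewrite -rankQ; apply: (dmaxQ (K / 'L_3(G))%G).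
    have sLK := subset_trans (lcn_subS 2 G) sL2K.
    apply/andP; split; first exact: quotientS (proper_sub prK).
    by apply: contra (proper_subn prK) => sQK; rewrite -(quotientSGK nLG sLK).
  exact: acts_quotient_lcn.
- move=> dmax; apply: d_maximal_quotient_lcn3 => // H prHG actH sLH.
  apply: leq_ltn_trans (dmax H prHG actH sLH); apply: quotient_grank.
  exact: subset_trans (proper_sub prHG) nLG.
Qed.
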